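(* Let $\alpha,\beta\in\mathbb{N}_0$ and let $M,N>0$ be real numbers. The polynomial eigenfunctions $y_n(x)=P_n^{\alpha,\beta,M,N}(x)$, $n\in\mathbb{N}_0$, of the generalized Jacobi equation satisfy the orthogonality relation, for all $n,m\in\mathbb{N}_0$ with $n\ne m$, $$(y_n,y_m)_{w(\alpha,\beta,M,N)}=h_{\alpha,\beta}^{-1}\int_{-1}^{1}y_n(x)y_m(x)(1-x)^{\alpha}(1+x)^{\beta}dx+M\,y_n(-1)y_m(-1)+N\,y_n(1)y_m(1)=0.$$
   Context: $\mathbb{N}_0=\{0,1,2,\dots\}$; $(a)_k=a(a+1)\cdots(a+k-1)$, $(a)_0=1$, is the Pochhammer symbol; $D_x^i$ denotes $i$-fold differentiation with respect to $x$; $h_{\alpha,\beta}=\int_{-1}^1(1-x)^\alpha(1+x)^\beta dx$. Jacobi polynomials: $P_n^{\alpha,\beta}(x)=\frac{(\alpha+1)_n}{n!}\,{}_2F_1\big(-n,n+\alpha+\beta+1;\alpha+1;\frac{1-x}{2}\big)$, $n\in\mathbb{N}_0$. Koornwinder's generalized Jacobi polynomials: $P_n^{\alpha,\beta,M,N}(x)=P_n^{\alpha,\beta}(x)+MQ_n^{\alpha,\beta}(x)+NR_n^{\alpha,\beta}(x)+MNS_n^{\alpha,\beta}(x)$, $n\in\mathbb{N}_0$, where $Q_0^{\alpha,\beta}=R_0^{\alpha,\beta}=S_0^{\alpha,\beta}=S_1^{\alpha,\beta}=0$ and $Q_n^{\alpha,\beta}(x)=q_n^{\alpha,\beta}(x+1)P_{n-1}^{\alpha,\beta+2}(x)$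 with $q_n^{\alpha,\beta}=\frac{(\alpha+\beta+2)_n(\beta+2)_{n-1}}{2\,n!\,(\alpha+1)_{n-1}}$ for $n\ge1$; $R_n^{\alpha,\beta}(x)=r_n^{\alpha,\beta}(x-1)P_{n-1}^{\alpha+2,\beta}(x)$ with $r_n^{\alpha,\beta}=\frac{(\alpha+\beta+2)_n(\alpha+2)_{n-1}}{2\,n!\,(\beta+1)_{n-1}}$ for $n\ge1$; $S_n^{\alpha,\beta}(x)=s_n^{\alpha,\beta}(x^2-1)P_{n-2}^{\alpha+2,\beta+2}(x)$ with $s_n^{\alpha,\beta}=\frac{(\alpha+\beta+2)_n(\alpha+\beta+2)_{n+1}}{4(\alpha+1)(\beta+1)(n-1)!\,n!}$ for $n\ge2$. The generalized Jacobi equation (of which the $y_n$ are eigenfunctions) is $$\Big\{[L_{2,x}^{\alpha,\beta}-\Lambda_{2,n}^{\alpha,\beta}]+\tfrac{M}{b_{\beta,\alpha}}[\widetilde L_{2\beta+4,x}^{\beta,\alpha}-\Lambda_{2\beta+4,n}^{\beta,\alpha}]+\tfrac{N}{b_{\alpha,\beta}}[L_{2\alpha+4,x}^{\alpha,\beta}-\Lambda_{2\alpha+4,n}^{\alpha,\beta}]+\tfrac{MN}{c_{\alpha,\beta}}[L_{2\alpha+2\beta+6,x}^{\alpha,\beta}-\Lambda_{2\alpha+2\beta+6,n}^{\alpha,\beta}]\Big\}y_n(x)=0$$ with $b_{\alpha,\beta}=(\alpha+2)!(\beta+1)_{\alpha+1}$, $b_{\beta,\alpha}=(\beta+2)!(\alpha+1)_{\beta+1}$,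 $c_{\alpha,\beta}=(\alpha+1)(\beta+1)(\alpha+\beta+3)((\alpha+\beta+1)!)^2$; $\Lambda_{2,n}^{\alpha,\beta}=n(n+\alpha+\beta+1)$, $\Lambda_{2\alpha+4,n}^{\alpha,\beta}=(n)_{\alpha+2}(n+\beta)_{\alpha+2}$, $\Lambda_{2\beta+4,n}^{\beta,\alpha}=(n)_{\beta+2}(n+\alpha)_{\beta+2}$, $\Lambda_{2\alpha+2\beta+6,n}^{\alpha,\beta}=(n-1)_{\alpha+\beta+3}(n)_{\alpha+\beta+3}$; and $L_{2,x}^{\alpha,\beta}y=\frac{1}{(x-1)^{\alpha}(x+1)^{\beta}}D_x[(x-1)^{\alpha+1}(x+1)^{\beta+1}D_xy]$, $\widetilde L_{2\beta+4,x}^{\beta,\alpha}y=\frac{x+1}{(x-1)^{\alpha}}D_x^{\beta+2}\{(x-1)^{\alpha+\beta+2}D_x^{\beta+2}[(x+1)^{\beta+1}y]\}$, $L_{2\alpha+4,x}^{\alpha,\beta}y=\frac{x-1}{(x+1)^{\beta}}D_x^{\alpha+2}\{(x+1)^{\alpha+\beta+2}D_x^{\alpha+2}[(x-1)^{\alpha+1}y]\}$, $L_{2\alpha+2\beta+6,x}^{\alpha,\beta}y=(x^2-1)D_x^{\alpha+\beta+3}\{(x-1)^{\beta+1}(x+1)^{\alpha+1}D_x^{\alpha+\beta+3}[(x-1)^{\alpha+1}(x+1)^{\beta+1}y]\}$. *)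

(* Defs.v *)
From mathcomp Require Import all_boot all_order all_algebra.
From mathcomp Require Import all_classical all_reals all_analysis.

Set Implicit Arguments.
Unset Strict Implicit.
Unset Printing Implicit Defensive.

Import Order.TTheory GRing.Theory Num.Theory.
Import numFieldNormedType.Exports.

Local Open Scope ring_scope.

Definition pochhammer (R : realType) (a : R) (k : nat) : R :=
  \prod_(i < k) (a + i%:R).

(* The terminating Gauss series 2F1(-n, b; c; X) as a polynomial in X: the
   terms of index k > n of the series vanish because (-n)_k = 0. *)
Definition hyp2F1 (R : realType) (n : nat) (b c : R) : {poly R} :=
  \poly_(k < n.+1)
    (pochhammer (- n%:R) k * pochhammer b k / (pochhammer c k * (k`!)%:R)).

Definition jacobi (R : realType) (a b n : nat) : {poly R} :=
  (pochhammer a.+1%:R n / (n`!)%:R) *: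
  (hyp2F1 n (n + a + b + 1)%:R a.+1%:R \Po (2^-1 *: (1 - 'X))).

Definition koornwinderQ (R : realType) (a b n : nat) : {poly R} :=
  if n is n'.+1 then
    (pochhammer (a + b + 2)%:R n * pochhammer (b + 2)%:R n'
     / (2 * (n`!)%:R * pochhammer (a + 1)%:R n')) *:
    (('X + 1) * jacobi R a (b + 2) n')
  else 0.

Definition koornwinderR (R : realType) (a b n : nat) : {poly R} :=
  if n is n'.+1 then
    (pochhammer (a + b + 2)%:R n * pochhammer (a + 2)%:R n'
     / (2 * (n`!)%:R * pochhammer (b + 1)%:R n')) *:
    (('X - 1) * jacobi R (a + 2) b n')
  else 0.

Definition koornwinderS (R : realType) (a b n : nat) : {poly R} :=
  if n is n'.+2 then
    (pochhammer (a + b + 2)%:R n * pochhammer (a + b + 2)%:R n.+1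
     / (4 * (a + 1)%:R * (b + 1)%:R * ((n.-1)`!)%:R * (n`!)%:R)) *:
    (('X^2 - 1) * jacobi R (a + 2) (b + 2) n')
  else 0.

Definition genjacobi (R : realType) (a b : nat) (M N : R) (n : nat) : {poly R} :=
  jacobi R a b n + M *: koornwinderQ R a b n + N *: koornwinderR R a b n
  + (M * N) *: koornwinderS R a b n.

Definition jacobi_mass (R : realType) (a b : nat) : R :=
  \int[lebesgue_measure]_(x in `[(-1 : R), 1]%classic)
    ((1 - x) ^+ a * (1 + x) ^+ b).

Definition genjacobi_dot (R : realType) (a b : nat) (M N : R) (f g : R -> R) : R :=
  (jacobi_mass R a b)^-1 *
    (\int[lebesgue_measure]_(x in `[(-1 : R), 1]%classic)
       (f x * g x * (1 - x) ^+ a * (1 + x) ^+ b))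
  + M * f (-1) * g (-1) + N * f 1 * g 1.

(* Main.v *)
Require Import Defs.
From HB Require Import structures.
From mathcomp Require Import all_boot all_order all_algebra.
From mathcomp Require Import all_classical all_reals all_analysis.
From mathcomp Require Import ring lra zify.
Import Order.TTheory GRing.Theory Num.Theory.
Import numFieldNormedType.Exports.
Local Open Scope ring_scope.

(* With t = (1-x)/2 and v = (1+x)/2, the Jacobi polynomial is
   sum_s (-1)^s C(n+a,n-s) C(n+b,s) t^s v^(n-s), so its integrals against
   t^a v^c reduce by the Beta integral to n-th finite differences: they vanish
   for b <= c < b+n and are explicit for c = b-1.  It suffices to show that y_n
   is orthogonal to every f of degree < n.  For n >= 2 write
   f = f(-1) t + f(1) v + t v g with deg g < n-2.  Each of the four summands of
   y_n is separately orthogonal to t v g.  For f = v only the integrals of R_n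
   and S_n survive, and they cancel the mass N y_n(1), where y_n(1) is
   P_n(1) + M Q_n(1); the case f = t follows by the reflection x |-> -x, which
   exchanges (a,M) and (b,N).  For n = 1 only f = 1 has to be checked. *)

(** * Factorials as nonzero scalars *)

Section Factorials.
Context {R : realType}.

Lemma fact_neq0 n : (n`!)%:R != 0 :> R.
Proof. by rewrite pnatr_eq0 -lt0n fact_gt0. Qed.

Lemma factSR n : (n.+1`!)%:R = n.+1%:R * (n`!)%:R :> R.
Proof. by rewrite factS natrM. Qed.
End Factorials.

(** * Integrals of polynomials over [-1, 1], and the Beta integral *)

Section PolyIntegral.
Local Open Scope classical_set_scope.
Local Open Scope ring_scope.
Context {R : realType}.
Implicit Types p q : {poly R}.

Definition polyint p : R :=
  \int[lebesgue_measure]_(x in `[(-1 : R), 1]%classic) p.[x].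

(** The fundamental theorem of calculus. Combined with [poly_primitive], it reduces linearity,
    reflection and the Beta integral to endpoint values, so no integrability conditions arise
    later. *)
Lemma polyint_deriv p : polyint p^`() = p.[1] - p.[-1].
Proof.
have lt11 : -1 < 1 :> R by lra.
have cont q : {within `[(-1 : R), 1]%classic, continuous (horner q)}.
  by apply: continuous_subspaceT => x; exact: continuous_horner.
rewrite /polyint /Rintegral (continuous_FTC2 (F := horner p) lt11 (cont _)) //.
- split.
  + by move=> x _; exact: derivable_horner.
  + by apply: cvg_at_right_filter; exact: continuous_horner.
  + by apply: cvg_at_left_filter; exact: continuous_horner.
- by move=> x _; rewrite derive1E derive_val.
Qed.

Lemma poly_primitive p : exists q, p = q^`().
Proof.
(* At [i = 0] this divides by zero, which yields 0; derivation discards that constant term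
   anyway. *)
exists (\poly_(i < (size p).+1) (p`_i.-1 / i%:R)).
apply/polyP=> i; rewrite coef_deriv coef_poly ltnS /=.
case: ltnP => [_|le_pi]; last by rewrite mul0rn nth_default.
by rewrite -[RHS]mulr_natr divfK ?pnatr_eq0.
Qed.

Lemma polyint_linear : linear (polyint : {poly R} -> R^o).
Proof.
move=> c p q; have [P ->] := poly_primitive p; have [Q ->] := poly_primitive q.
rewrite -derivZ -derivD !polyint_deriv !hornerE /GRing.scale /=; ring.
Qed.

HB.instance Definition _ :=
  GRing.isLinear.Build R {poly R} R^o _ polyint polyint_linear.

Lemma polyintZ c p : polyint (c *: p) = c * polyint p.
Proof. by rewrite linearZ. Qed.

Lemma polyint_reflect p : polyint (p \Po - 'X) = polyint p.
Proof.
have [P ->] := poly_primitive p.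
have -> : P^`() \Po - 'X = (- (P \Po - 'X))^`().
  by rewrite derivN deriv_comp derivN derivX mulrN1 opprK.
rewrite !polyint_deriv !hornerE !horner_comp !hornerE !opprK; ring.
Qed.

Definition tX : {poly R} := 2^-1 *: (1 - 'X).
Definition vX : {poly R} := 2^-1 *: (1 + 'X).

Lemma tXE x : tX.[x] = 2^-1 * (1 - x). Proof. by rewrite !hornerE. Qed.
Lemma vXE x : vX.[x] = 2^-1 * (1 + x). Proof. by rewrite !hornerE. Qed.

(** Induction on the exponent of [vX]: integration by parts trades one factor [vX] for one factor
    [tX], down to a pure power of [tX]. *)
Lemma polyint_beta i j :
  polyint (tX ^+ i * vX ^+ j) = 2 * (i`! * j`!)%:R / ((i + j).+1`!)%:R.
Proof.
have dt k : (tX ^+ k.+1)^`() = (- (2^-1 * k.+1%:R)) *: tX ^+ k.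
  rewrite deriv_exp derivZ derivB derivX derivC sub0r scalerN alg_polyC.
  by rewrite mulNr mul_polyC -scaleNr -scaler_nat scalerA; congr (_ *: _); ring.
have dv k : (vX ^+ k.+1)^`() = (2^-1 * k.+1%:R) *: vX ^+ k.
  rewrite deriv_exp derivZ derivD derivX derivC add0r alg_polyC.
  by rewrite mul_polyC -scaler_nat scalerA; congr (_ *: _); ring.
elim: j i => [|j IHj] i.
  have := polyint_deriv (tX ^+ i.+1).
  rewrite dt linearZ /= !horner_exp !tXE subrr mulr0 expr0n /= expr0 mulr1.
  rewrite (_ : 2^-1 * (1 - -1) = 1 :> R) ?expr1n; last by field.
  rewrite fact0 addn0 muln1 factS natrM /GRing.scale /= => H.
  have iS : i.+1%:R != 0 :> R by rewrite pnatr_eq0.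
  apply: (mulfI (x := - (2^-1 * i.+1%:R))).
    by rewrite oppr_eq0 mulf_neq0 ?invr_eq0 ?pnatr_eq0.
  by rewrite H; field; rewrite fact_neq0 nat1r.
(* This product vanishes at both endpoints, so the two integrals produced by the product rule are
   proportional. *)
have := polyint_deriv (tX ^+ i.+1 * vX ^+ j.+1).
rewrite derivM dt dv !hornerM !horner_exp !tXE !vXE.
rewrite !(subrr, addrN) !(mulr0, mul0r) !expr0n /= !(mul0r, mulr0) subrr.
rewrite -scalerAl -scalerAr linearD !linearZ /= IHj addSn addnS.
rewrite !factS !natrM /GRing.scale /= => H.
have iS : i.+1%:R != 0 :> R by rewrite pnatr_eq0.
apply: (mulfI (x := 2^-1 * i.+1%:R)); first by rewrite mulf_neq0 ?invr_eq0 ?pnatr_eq0.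
rewrite -[LHS]addr0 -H; set I1 := polyint _.
by field; rewrite fact_neq0 -!natrD nat1r !pnatr_eq0.
Qed.
End PolyIntegral.

(** * Iterated forward differences *)

Section FiniteDifferences.
Context {R : realType}.

Definition findiff (f : nat -> R) : nat -> R := fun y => f y.+1 - f y.

(** Pascal's rule. The sum is indexed from the top node [y + n] downwards, so that its signs and its
    nodes [n - s] match the powers of [vX] in [jacobi_tXvX]. *)
Lemma iter_findiffE n f y :
  iter n findiff f y = \sum_(s < n.+1) (-1) ^+ s * 'C(n, s)%:R * f (y + (n - s))%N.
Proof.
elim: n y => [|n IHn] y.
  by rewrite big_ord1 /= expr0 bin0 !mul1r addn0.
rewrite iterS /findiff !IHn [RHS]big_ord_recl /= bin0.
under [X in _ = _ + X]eq_bigr => s _.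
  rewrite /bump /= add1n binS natrD mulrDr mulrDl subSS.
  rewrite [in X in _ + X]exprS mulN1r !mulNr.
  over.
rewrite big_split /= sumrN addrA; congr (_ - _).
rewrite [in LHS]big_ord_recl [in RHS]big_ord_recr /=.
rewrite (bin_small (ltnSn n)) mulr0 mul0r addr0 bin0.
congr (_ + _); first by rewrite subn0 addSnnS.
by apply: eq_bigr => s _; rewrite /bump /= add1n exprS mulN1r addSnnS -subSn.
Qed.

(** By Pascal's rule each difference lowers [j] by one, until the function is constant. The factor
    [x] leaves room for the [j!] that turns a binomial into a quotient of factorials. *)
Lemma iter_findiff_bin n c j (x : R) y :
  (j < n)%N -> iter n findiff (fun z => 'C(c + z, j)%:R * x) y = 0.
Proof.
elim: n j y => // n IHn j y; rewrite iterSr => lt_jn.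
case: j lt_jn => [|j] lt_jn.
  have -> : findiff (fun z => 'C(c + z, 0)%:R * x) = fun=> 0.
    by apply/funext => z; rewrite /findiff !bin0 subrr.
  by elim: n {IHn lt_jn} y => // n IHn y; rewrite iterS /findiff !IHn subrr.
have -> : findiff (fun z => 'C(c + z, j.+1)%:R * x) = fun z => 'C(c + z, j)%:R * x.
  by apply/funext => z; rewrite /findiff -mulrBl addnS binS natrD addrC addKr.
exact: IHn.
Qed.

(** The n-th difference appends one linear factor to the denominator and multiplies the numerator by
    -n. *)
Lemma iter_findiff_inv n c y :
  iter n findiff (fun z => (c + z).+1%:R^-1) y =
  (-1) ^+ n * (n`!)%:R * ((c + y)`!)%:R / ((c + y + n).+1`!)%:R.
Proof.
elim: n y => [|n IHn] y.
  rewrite /= addn0 expr0 fact0 factS natrM; field.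
  by rewrite fact_neq0 -natrD nat1r pnatr_eq0.
rewrite iterS /findiff !IHn addnS addSn addnS !factS !natrM exprS; field.
by rewrite fact_neq0 -!natrD nat1r !pnatr_eq0.
Qed.
End FiniteDifferences.

(** * Expansions of the Jacobi polynomials with binomial coefficients *)

Section JacobiPolynomials.
Context {R : realType}.

Lemma pochhammer_fact c k :
  pochhammer (c.+1%:R : R) k = ((c + k)`!)%:R / (c`!)%:R.
Proof.
rewrite /pochhammer; elim: k => [|k IHk].
  by rewrite big_ord0 addn0 divff ?fact_neq0.
by rewrite big_ord_recr /= IHk addnS factS natrM; field; rewrite fact_neq0.
Qed.

Lemma pochhammer_opp n k : (k <= n)%N ->
  pochhammer (- n%:R : R) k = (-1) ^+ k * (n`!)%:R / ((n - k)`!)%:R.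
Proof.
rewrite /pochhammer; elim: k => [|k IHk] le_kn.
  by rewrite big_ord0 subn0 expr0 mul1r divff ?fact_neq0.
rewrite big_ord_recr /= IHk 1?ltnW // -(subnSK le_kn) factS natrM subnSK //.
have nk : (n - k)%:R != 0 :> R by rewrite pnatr_eq0 subn_eq0 -ltnNge.
rewrite (_ : - n%:R + k%:R = - (n - k)%:R); last by rewrite natrB 1?ltnW // opprB addrC.
by rewrite exprS; field; rewrite fact_neq0.
Qed.

(** The splitting of [p] is a premise so that [lia] can justify any form of the arguments; binomial
    identities then become quotients of factorials, which [field] settles. *)
Lemma natr_bin p q r : p = (q + r)%N ->
  'C(p, q)%:R = (p`!)%:R / ((q`!)%:R * (r`!)%:R) :> R.
Proof.
move=> ->; rewrite -(bin_fact (leq_addr r q)) addKn !natrM.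
by field; rewrite !fact_neq0.
Qed.

(** For natural parameters every Pochhammer symbol is a signed quotient of factorials, and these
    regroup into two binomials. *)
Lemma jacobi_tX a b n : jacobi R a b n =
  \sum_(k < n.+1) ((-1) ^+ k * ('C(n + a, n - k) * 'C(n + a + b + k, k))%:R) *: tX ^+ k.
Proof.
rewrite /jacobi /hyp2F1 poly_def raddf_sum /= scaler_sumr.
apply: eq_bigr => k _; have le_kn : (k <= n)%N by rewrite -ltnS.
rewrite comp_polyZ comp_Xn_poly scalerA; congr (_ *: _).
rewrite addn1 !pochhammer_fact pochhammer_opp // natrM (addnC a n).
rewrite (natr_bin _ _ (a + k)) 1?(natr_bin _ k (n + a + b)); [|by lia|by lia].
by field; rewrite !fact_neq0.
Qed.

Lemma big_triangle (V : nmodType) n (G : nat -> nat -> V) :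
  \sum_(0 <= s < n) \sum_(s <= k < n) G s k =
  \sum_(0 <= k < n) \sum_(0 <= s < k.+1) G s k.
Proof.
elim: n => [|n IHn]; first by rewrite !big_geq.
rewrite big_nat_recr //= [RHS]big_nat_recr //= -IHn big_nat1.
rewrite [X in _ = _ + X]big_nat_recr //= addrA -big_split /=; congr (_ + _).
by apply: eq_big_nat => s /andP[_ lt_sn]; rewrite big_nat_recr 1?ltnW.
Qed.

Lemma tXvX : tX + vX = 1 :> {poly R}.
Proof.
rewrite -scalerDr (_ : 1 - 'X + (1 + 'X) = 2%:R *: 1); last first.
  by rewrite scaler_nat; ring.
by rewrite scalerA mulVf ?scale1r // pnatr_eq0.
Qed.

(* Expanding vX = 1 - tX, this is Vandermonde's convolution coefficientwise. *)
Lemma jacobi_tXvX a b n : jacobi R a b n =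
  \sum_(s < n.+1)
    ((-1) ^+ s * ('C(n + a, n - s) * 'C(n + b, s))%:R) *: (tX ^+ s * vX ^+ (n - s)).
Proof.
pose G s k : {poly R} := ((-1) ^+ k *
  ('C(n + a, n - s) * 'C(n + b, s) * 'C(n - s, k - s))%:R) *: tX ^+ k.
have -> : \sum_(s < n.+1) ((-1) ^+ s * ('C(n + a, n - s) * 'C(n + b, s))%:R) *:
    (tX ^+ s * vX ^+ (n - s)) = \sum_(0 <= s < n.+1) \sum_(s <= k < n.+1) G s k.
  rewrite big_mkord; apply: eq_bigr => s _.
  have le_sn : (s <= n)%N by rewrite -ltnS.
  rewrite -[X in \sum_(X <= _ < _) _]add0n big_addn subSn // big_mkord.
  rewrite (_ : vX = 1 - tX); last by rewrite -tXvX addrC addKr.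
  rewrite exprBn mulr_sumr scaler_sumr; apply: eq_bigr => i _.
  rewrite /G addnK expr1n mulr1 [X in _ *: X]mulrC.
  rewrite (_ : (-1) ^+ i = ((-1) ^+ i : R)%:P); last by rewrite rmorphXn rmorphN1.
  rewrite mul_polyC -(scaler_nat 'C(n - s, i)) -!scalerAl !scalerA -exprD.
  by congr (_ *: _); rewrite exprD !natrM; ring.
rewrite big_triangle jacobi_tX big_mkord; apply: eq_bigr => k _.
have le_kn : (k <= n)%N by rewrite -ltnS.
rewrite big_mkord -scaler_suml -mulr_sumr -natr_sum; congr ((_ * _%:R) *: _).
rewrite (_ : n + a + b + k = n + b + (a + k))%N; last by lia.
rewrite -(binomial.Vandermonde (n + b) (a + k) k) big_distrr /=; apply: eq_bigr => s _.
have le_sk : (s <= k)%N by rewrite -ltnS.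
rewrite mulnCA [RHS]mulnAC [RHS]mulnC; congr (_ * _)%N.
(* What remains is C(n+a, n-s) C(n-s, k-s) = C(n+a, n-k) C(a+k, k-s): both sides are (n+a)! /
   ((a+s)! (k-s)! (n-k)!). *)
apply/eqP; rewrite -(eqr_nat R) !natrM; apply/eqP.
rewrite (natr_bin _ _ (a + k)) 1?(natr_bin (a + k) _ (a + s)); [|by lia|by lia].
rewrite (natr_bin _ _ (a + s)) 1?(natr_bin (n - s) _ (n - k)); [|by lia|by lia].
by field; rewrite !fact_neq0.
Qed.
End JacobiPolynomials.

(** * Integrals of Jacobi polynomials against powers of t and v *)

Section JacobiIntegrals.
Context {R : realType}.

(* After integrating termwise, (n+a)! and (n+b)! factor out and the remaining
   alternating sum is an n-th finite difference: of a polynomial of degree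
   c - b if c >= b, of y |-> 1/(b+y) if c = b - 1. *)
Lemma polyint_jacobi a b c n :
  polyint (jacobi R a b n * (tX ^+ a * vX ^+ c)) =
  2 * ((n + a)`! * (n + b)`!)%:R / ((a + c + n).+1`! * n`!)%:R *
  iter n findiff (fun y => ((c + y)`!)%:R / ((b + y)`!)%:R) 0%N.
Proof.
rewrite jacobi_tXvX mulr_suml raddf_sum /= iter_findiffE mulr_sumr.
apply: eq_bigr => s _; have le_sn : (s <= n)%N by rewrite -ltnS.
rewrite -scalerAl mulrACA -!exprD linearZ /= polyint_beta /GRing.scale /=.
rewrite (_ : s + a + (n - s + c) = a + c + n)%N; last by lia.
(* [natrM] would unfold the factorial of a successor into a product. *)
move: (_ .+1`!) (@fact_neq0 R (a + c + n).+1) => F F0.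
rewrite !natrM (natr_bin (n + a) _ (a + s)); last by lia.
rewrite (natr_bin (n + b) _ (n + b - s)); last by lia.
rewrite (natr_bin n s (n - s)); last by lia.
rewrite (_ : n + b - s = b + (0 + (n - s)))%N; last by lia.
rewrite (_ : n - s + c = c + (0 + (n - s)))%N; last by lia.
rewrite (addnC s a) add0n.
by field; rewrite !fact_neq0 F0.
Qed.

(** Expand [f] in powers of [vX]. A power [vX ^+ j] raises the weight exponent to [b + j], and the
    function to be differenced becomes [j!] times a binomial of degree j < n, which n differences
    annihilate. *)
Lemma jacobi_orthogonal a b n (f : {poly R}) : (size f <= n)%N ->
  polyint (jacobi R a b n * (tX ^+ a * vX ^+ b) * f) = 0.
Proof.
move=> size_f.
(* The inner substitution x = 2 (v - 1/2) inverts [vX]. *)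
have -> : f = (f \Po (2%:R *: ('X - (2^-1)%:P))) \Po vX.
  rewrite -comp_polyA comp_polyZ comp_polyB comp_polyX comp_polyC.
  rewrite scalerBr scalerA divff ?pnatr_eq0 // scale1r -mul_polyC -polyCM.
  by rewrite divff ?pnatr_eq0 // addrAC subrr add0r comp_polyXr.
rewrite comp_polyE mulr_sumr raddf_sum /= big1 // => j _.
have lt_jn : (j < n)%N.
  apply: leq_trans size_f; apply: leq_trans (ltn_ord j) _.
  by rewrite size_comp_poly2 // size_scale ?pnatr_eq0 // size_XsubC.
rewrite -scalerAr linearZ /= -!mulrA -exprD polyint_jacobi.
rewrite (_ : (fun y => _) = fun y => 'C(b + j + y, j)%:R * (j`!)%:R).
  by rewrite iter_findiff_bin // mulr0 scaler0.
apply/funext => y; rewrite (natr_bin _ j (b + y)); last by lia.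
by field; rewrite !fact_neq0.
Qed.

Lemma polyint_jacobi_pred a c n :
  polyint (jacobi R a c.+1 n * (tX ^+ a * vX ^+ c)) =
  2 * (-1) ^+ n * ((n + a)`!)%:R * (c`!)%:R / ((a + c + n).+1`!)%:R.
Proof.
rewrite polyint_jacobi.
rewrite (_ : (fun y => _) = fun y => (c + y).+1%:R^-1); last first.
  apply/funext => y; rewrite addSn factS natrM; field.
  by rewrite fact_neq0 -natrD nat1r pnatr_eq0.
rewrite iter_findiff_inv addn0 (addnS n c) (addnC c n).
move: ((a + c + n).+1`!) (@fact_neq0 R (a + c + n).+1) => F F0.
move: ((n + c).+1`!) (@fact_neq0 R (n + c).+1) => G G0.
by rewrite !natrM; field; rewrite F0 G0 fact_neq0.
Qed.
End JacobiIntegrals.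

(** * Koornwinder's summands: normal forms, reflection and degree bounds *)

Section Koornwinder.
Context {R : realType}.

Lemma tX_reflect : (tX : {poly R}) \Po - 'X = vX.
Proof. by rewrite comp_polyZ comp_polyB comp_polyX -polyC1 comp_polyC opprK. Qed.

Lemma vX_reflect : (vX : {poly R}) \Po - 'X = tX.
Proof. by rewrite comp_polyZ comp_polyD comp_polyX -polyC1 comp_polyC. Qed.

Lemma tX1 : (tX : {poly R}).[1] = 0. Proof. by rewrite tXE subrr mulr0. Qed.
Lemma vX1 : (vX : {poly R}).[1] = 1.
Proof. by rewrite vXE mulVf // pnatr_eq0. Qed.
Lemma tXN1 : (tX : {poly R}).[-1] = 1.
Proof. by rewrite tXE opprK mulVf // pnatr_eq0. Qed.
Lemma vXN1 : (vX : {poly R}).[-1] = 0. Proof. by rewrite vXE addrN mulr0. Qed.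

Lemma size_tX : size (tX : {poly R}) = 2%N.
Proof. by rewrite size_scale ?invr_eq0 ?pnatr_eq0 // -opprB size_polyN size_XsubC. Qed.

Lemma size_vX : size (vX : {poly R}) = 2%N.
Proof. by rewrite size_scale ?invr_eq0 ?pnatr_eq0 // addrC size_XaddC. Qed.

(** Reflection swaps [tX] and [vX]; reversing the summation index then exchanges [a] and [b] and
    leaves the sign (-1)^n. *)
Lemma jacobi_reflect a b n :
  jacobi R a b n \Po - 'X = (-1) ^+ n *: jacobi R b a n.
Proof.
rewrite !jacobi_tXvX raddf_sum /= scaler_sumr (reindex_inj rev_ord_inj) /=.
apply: eq_bigr => s _; have le_sn : (s <= n)%N by rewrite -ltnS.
rewrite comp_polyZ comp_polyM !rmorphXn /= tX_reflect vX_reflect subSS subKn //.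
rewrite scalerA mulrA (mulrC (vX ^+ _)) (mulnC 'C(_, _)).
by rewrite -signr_odd oddB // signr_addb !signr_odd.
Qed.

Lemma jacobi_at1 a b n : (jacobi R a b n).[1] = 'C(n + a, n)%:R.
Proof.
rewrite jacobi_tX horner_sum big_ord_recl big1 ?addr0.
  rewrite hornerZ /=.
  by rewrite !expr0 hornerC mul1r mulr1 subn0 bin0 muln1.
by move=> k _; rewrite hornerZ horner_exp tX1 expr0n mulr0.
Qed.

Lemma size_jacobi a b n : (size (jacobi R a b n) <= n.+1)%N.
Proof.
rewrite jacobi_tX; apply: leq_trans (size_sum _ _ _) _; apply/bigmax_leqP => k _.
apply: leq_trans (size_scale_leq _ _) _; apply: leq_trans (size_poly_exp_leq _ _) _.
by rewrite size_tX mul1n.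
Qed.

(** The mirror image of [polyint_jacobi_pred]; the sign from the reflection cancels the one in that
    formula. *)
Lemma polyint_jacobi_predl b c n :
  polyint (jacobi R c.+1 b n * (tX ^+ c * vX ^+ b)) =
  2 * ((n + b)`!)%:R * (c`!)%:R / ((b + c + n).+1`!)%:R.
Proof.
rewrite -polyint_reflect !comp_polyM !rmorphXn /= tX_reflect vX_reflect.
rewrite jacobi_reflect -scalerAl linearZ /= (mulrC (vX ^+ _)) polyint_jacobi_pred.
have sign2 : (-1) ^+ n * (-1) ^+ n = 1 :> R by rewrite -expr2 sqrr_sign.
rewrite /GRing.scale /= -!mulrA mulrCA; congr (_ * _).
by rewrite (mulrA ((-1) ^+ n) ((-1) ^+ n)) sign2 mul1r.
Qed.

(* This is 2 q_(n+1); exchanging a and b gives 2 r_(n+1). *)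
Definition koornwinderQ_coef a b n : R :=
  ((a + b + n).+2`!)%:R * ((b + n).+1`!)%:R * (a`!)%:R /
  (((a + b).+1`!)%:R * (b.+1`!)%:R * (n.+1`!)%:R * ((a + n)`!)%:R).

Lemma addX1 : 'X + 1 = 2 *: vX :> {poly R}.
Proof. by rewrite scalerA divff ?pnatr_eq0 // scale1r addrC. Qed.

Lemma subX1 : 'X - 1 = - 2 *: tX :> {poly R}.
Proof. by rewrite scalerA mulNr divff ?pnatr_eq0 // scaleN1r opprB. Qed.

Lemma koornwinderQ_S a b n : koornwinderQ R a b n.+1 =
  koornwinderQ_coef a b n *: (vX * jacobi R a (b + 2) n).
Proof.
rewrite /koornwinderQ addX1 -(scalerAl _ vX) scalerA; congr (_ *: _).
rewrite !addn2 !addn1 !pochhammer_fact /koornwinderQ_coef !addSn addnS.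
by field; rewrite !fact_neq0.
Qed.

Lemma koornwinderR_S a b n : koornwinderR R a b n.+1 =
  - koornwinderQ_coef b a n *: (tX * jacobi R (a + 2) b n).
Proof.
rewrite /koornwinderR subX1 -(scalerAl _ tX) scalerA; congr (_ *: _).
rewrite !addn2 !addn1 !pochhammer_fact /koornwinderQ_coef !addSn addnS (addnC b a).
by field; rewrite !fact_neq0.
Qed.

(* This is 4 s_(n+2). *)
Definition koornwinderS_coef a b n : R :=
  ((a + b + n).+3`!)%:R * ((a + b + n).+4`!)%:R /
  (((a + b).+1`!)%:R ^+ 2 * a.+1%:R * b.+1%:R * (n.+1`!)%:R * (n.+2`!)%:R).

(** The sign and the factor 4 come from x^2 - 1 = -4 t v. *)
Lemma koornwinderS_SS a b n : koornwinderS R a b n.+2 =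
  - koornwinderS_coef a b n *: (tX * vX * jacobi R (a + 2) (b + 2) n).
Proof.
have -> : koornwinderS R a b n.+2 =
    (pochhammer (a + b + 2)%:R n.+2 * pochhammer (a + b + 2)%:R n.+3
     / (4 * (a + 1)%:R * (b + 1)%:R * (n.+1`!)%:R * (n.+2`!)%:R)) *:
    (('X - 1) * ('X + 1) * jacobi R (a + 2) (b + 2) n).
  by rewrite /koornwinderS; congr (_ *: (_ * _)); ring.
rewrite subX1 addX1 -(scalerAl _ tX) -(scalerAr _ tX) scalerA.
rewrite -(scalerAl _ (tX * vX)) scalerA; congr (_ *: _).
rewrite !addn2 !addn1 !pochhammer_fact /koornwinderS_coef !addSn !addnS.
by field; rewrite !fact_neq0 !nat1r !pnatr_eq0.
Qed.

Lemma koornwinderS_coefC a b n : koornwinderS_coef a b n = koornwinderS_coef b a n.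
Proof. by rewrite /koornwinderS_coef (addnC b a); congr (_ / _); ring. Qed.

Lemma koornwinderQ_reflect a b n :
  koornwinderQ R a b n \Po - 'X = (-1) ^+ n *: koornwinderR R b a n.
Proof.
case: n => [|n]; first by rewrite comp_poly0 scaler0.
rewrite koornwinderQ_S koornwinderR_S comp_polyZ comp_polyM vX_reflect.
rewrite jacobi_reflect -scalerAr !scalerA; congr (_ *: _).
by rewrite exprS; ring.
Qed.

Lemma koornwinderR_reflect a b n :
  koornwinderR R a b n \Po - 'X = (-1) ^+ n *: koornwinderQ R b a n.
Proof.
case: n => [|n]; first by rewrite comp_poly0 scaler0.
rewrite koornwinderQ_S koornwinderR_S comp_polyZ comp_polyM tX_reflect.
rewrite jacobi_reflect -scalerAr !scalerA; congr (_ *: _).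
by rewrite exprS; ring.
Qed.

Lemma koornwinderS_reflect a b n :
  koornwinderS R a b n \Po - 'X = (-1) ^+ n *: koornwinderS R b a n.
Proof.
case: n => [|[|n]]; rewrite ?comp_poly0 ?scaler0 //.
rewrite !koornwinderS_SS comp_polyZ !comp_polyM tX_reflect vX_reflect.
rewrite jacobi_reflect -scalerAr !scalerA koornwinderS_coefC (mulrC vX).
by rewrite !exprS; congr (_ *: _); ring.
Qed.

Lemma genjacobi_reflect a b (M N : R) n :
  genjacobi a b M N n \Po - 'X = (-1) ^+ n *: genjacobi b a N M n.
Proof.
rewrite /genjacobi !comp_polyD jacobi_reflect !comp_polyZ koornwinderQ_reflect.
rewrite koornwinderR_reflect koornwinderS_reflect !scalerDr !scalerA (mulrC N M).
rewrite !(mulrC ((-1) ^+ n)) -!scalerA -!addrA; congr (_ + _).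
by rewrite addrCA.
Qed.

Lemma size_genjacobi a b (M N : R) n : (size (genjacobi a b M N n) <= n.+1)%N.
Proof.
have sizeZ c (p : {poly R}) m : (size p <= m)%N -> (size (c *: p) <= m)%N.
  exact/leq_trans/size_scale_leq.
have sizeD (p q : {poly R}) m :
    (size p <= m)%N -> (size q <= m)%N -> (size (p + q)%R <= m)%N.
  by move=> pm qm; apply: leq_trans (size_polyD p q) _; rewrite geq_max pm.
have sizeM (p q : {poly R}) m :
    size p = 2%N -> (size q <= m)%N -> (size (p * q)%R <= m.+1)%N.
  move=> p2 qm; apply: leq_trans (size_polyMleq p q) _.
  by rewrite p2 add2n.
apply: (sizeD); first apply: (sizeD); first apply: (sizeD).
- exact: size_jacobi.
- apply: (sizeZ); case: n => [|n]; first by rewrite size_poly0.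
  rewrite koornwinderQ_S; apply: (sizeZ); apply: (sizeM);
    [exact: size_vX|exact: size_jacobi].
- apply: (sizeZ); case: n => [|n]; first by rewrite size_poly0.
  rewrite koornwinderR_S; apply: (sizeZ); apply: (sizeM);
    [exact: size_tX|exact: size_jacobi].
- apply: (sizeZ); case: n => [|[|n]]; rewrite ?size_poly0 //.
  rewrite koornwinderS_SS -mulrA; apply: (sizeZ); apply: (sizeM); first exact: size_tX.
  by apply: sizeM; [exact: size_vX|exact: size_jacobi].
Qed.
End Koornwinder.

(** * Orthogonality with respect to the weight and the two point masses *)

Section Orthogonality.
Context {R : realType}.
Implicit Types (f g y : {poly R}) (M N : R).

(** The weight is written in [tX] and [vX]; the resulting factor 2^(a+b) cancels against the one in
    the normalizing mass. *)
Definition polydot a b M N y f : R :=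
  polyint (y * (tX ^+ a * vX ^+ b) * f) / polyint (tX ^+ a * vX ^+ b)
  + M * y.[-1] * f.[-1] + N * y.[1] * f.[1].

Lemma genjacobi_dotE a b M N y f :
  genjacobi_dot a b M N (horner y) (horner f) = polydot a b M N y f.
Proof.
have weightE x :
    (1 - x) ^+ a * (1 + x) ^+ b = 2 ^+ (a + b) * (tX ^+ a * vX ^+ b).[x] :> R.
  rewrite hornerM !horner_exp tXE vXE exprD !exprMn !exprVn.
  by field; rewrite !expf_neq0 ?pnatr_eq0.
rewrite /genjacobi_dot /polydot; congr (_ + _ + _).
have -> : jacobi_mass R a b = 2 ^+ (a + b) * polyint (tX ^+ a * vX ^+ b).
  rewrite -polyintZ /jacobi_mass /polyint.
  by congr Rintegral; apply/funext => x; rewrite hornerZ weightE.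
have -> : \int[lebesgue_measure]_(x in `[(-1 : R), 1]%classic)
    (y.[x] * f.[x] * (1 - x) ^+ a * (1 + x) ^+ b) =
    2 ^+ (a + b) * polyint (y * (tX ^+ a * vX ^+ b) * f).
  rewrite -polyintZ /polyint.
  congr Rintegral; apply/funext => x.
  by rewrite -mulrA weightE hornerZ [in RHS]hornerM (hornerM y); ring.
by rewrite invfM mulrACA mulVf ?mul1r 1?mulrC // expf_neq0 ?pnatr_eq0.
Qed.

Lemma polydotC a b M N y f : polydot a b M N y f = polydot a b M N f y.
Proof. by rewrite /polydot mulrAC (mulrC y) mulrAC (mulrAC M) (mulrAC N). Qed.

Lemma polydotDr a b M N y f g :
  polydot a b M N y (f + g) = polydot a b M N y f + polydot a b M N y g.
Proof. by rewrite /polydot mulrDr linearD !hornerD /=; ring. Qed.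

Lemma polydotZr a b M N y c f :
  polydot a b M N y (c *: f) = c * polydot a b M N y f.
Proof.
by rewrite /polydot -scalerAr polyintZ !hornerZ; ring.
Qed.

Lemma polydotZl a b M N y c f :
  polydot a b M N (c *: y) f = c * polydot a b M N y f.
Proof. by rewrite polydotC polydotZr polydotC. Qed.

Lemma polydot_reflect a b M N y f :
  polydot a b M N (y \Po - 'X) (f \Po - 'X) = polydot b a N M y f.
Proof.
have weight_reflect :
    tX ^+ a * vX ^+ b = (tX ^+ b * vX ^+ a) \Po - 'X :> {poly R}.
  by rewrite comp_polyM !rmorphXn /= tX_reflect vX_reflect mulrC.
rewrite /polydot weight_reflect -!comp_polyM !polyint_reflect !horner_comp.
by rewrite !hornerN !hornerX opprK addrAC.
Qed.

Lemma weight_mass a b : polyint (tX ^+ a * vX ^+ b : {poly R}) =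
  2 * (a`!)%:R * (b`!)%:R / ((a + b).+1`!)%:R.
Proof.
rewrite polyint_beta; move: (_.+1`!) => F.
by rewrite natrM mulrA.
Qed.

Lemma polyint_genjacobi a b M N n f :
  polyint (genjacobi a b M N n * (tX ^+ a * vX ^+ b) * f) =
    polyint (jacobi R a b n * (tX ^+ a * vX ^+ b) * f)
  + M * polyint (koornwinderQ R a b n * (tX ^+ a * vX ^+ b) * f)
  + N * polyint (koornwinderR R a b n * (tX ^+ a * vX ^+ b) * f)
  + M * N * polyint (koornwinderS R a b n * (tX ^+ a * vX ^+ b) * f).
Proof.
have scaleE c p : polyint (c *: p * (tX ^+ a * vX ^+ b) * f) =
    c * polyint (p * (tX ^+ a * vX ^+ b) * f) by rewrite -!scalerAl polyintZ.
by rewrite /genjacobi !mulrDl !linearD /= (scaleE M) (scaleE N) (scaleE (M * N)).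
Qed.

(** The factor [vX] of Q raises the weight exponent to b + 1, one short of the exponent b + 2 for
    which its Jacobi factor is orthogonal. *)
Lemma polyint_koornwinderQ a b n f :
  polyint (koornwinderQ R a b n.+1 * (tX ^+ a * vX ^+ b) * f) =
  koornwinderQ_coef a b n *
  polyint (jacobi R a (b + 2) n * (tX ^+ a * vX ^+ b.+1) * f).
Proof.
rewrite koornwinderQ_S -polyintZ.
(* Abstracting keeps [scalerAl] and [ring] from unfolding these to scalings. *)
move: (jacobi _ _ _ _) tX vX => J t v; rewrite -!scalerAl !exprS.
by congr (polyint (_ *: _)); ring.
Qed.

Lemma polyint_koornwinderR a b n f :
  polyint (koornwinderR R a b n.+1 * (tX ^+ a * vX ^+ b) * f) =
  - koornwinderQ_coef b a n *
  polyint (jacobi R (a + 2) b n * (tX ^+ a.+1 * vX ^+ b) * f).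
Proof.
rewrite koornwinderR_S -polyintZ.
move: (jacobi _ _ _ _) tX vX => J t v; rewrite -!scalerAl !exprS.
by congr (polyint (_ *: _)); ring.
Qed.

Lemma polyint_koornwinderS a b n f :
  polyint (koornwinderS R a b n.+2 * (tX ^+ a * vX ^+ b) * f) =
  - koornwinderS_coef a b n *
  polyint (jacobi R (a + 2) (b + 2) n * (tX ^+ a.+1 * vX ^+ b.+1) * f).
Proof.
rewrite koornwinderS_SS -polyintZ.
move: (jacobi _ _ _ _) tX vX => J t v; rewrite -!scalerAl !exprS.
by congr (polyint (_ *: _)); ring.
Qed.

(** The factor [tX * vX] removes both point masses and supplies the powers missing from the weights
    of Q, R and S. The cofactors left over, [tX * g], [vX * g] and [g], are small enough for Jacobi
    indices n+1, n+1 and n. *)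
Lemma genjacobi_dot_interior a b M N n g : (size g <= n)%N ->
  polydot a b M N (genjacobi a b M N n.+2) (tX * vX * g) = 0.
Proof.
move=> size_g.
have sizetg : (size (tX * g)%R <= n.+1)%N.
  by apply: leq_trans (size_polyMleq _ _) _; rewrite size_tX add2n.
have sizevg : (size (vX * g)%R <= n.+1)%N.
  by apply: leq_trans (size_polyMleq _ _) _; rewrite size_vX add2n.
have sizetvg : (size (tX * vX * g)%R <= n.+2)%N.
  by rewrite -mulrA; apply: leq_trans (size_polyMleq _ _) _; rewrite size_tX add2n.
have moveQ (J : {poly R}) : J * (tX ^+ a * vX ^+ b.+1) * (tX * vX * g) =
    J * (tX ^+ a * vX ^+ (b + 2)) * (tX * g) by rewrite addn2 !exprS; ring.
have moveR (J : {poly R}) : J * (tX ^+ a.+1 * vX ^+ b) * (tX * vX * g) =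
    J * (tX ^+ (a + 2) * vX ^+ b) * (vX * g) by rewrite addn2 !exprS; ring.
have moveS (J : {poly R}) : J * (tX ^+ a.+1 * vX ^+ b.+1) * (tX * vX * g) =
    J * (tX ^+ (a + 2) * vX ^+ (b + 2)) * g by rewrite !addn2 !exprS; ring.
rewrite /polydot polyint_genjacobi.
rewrite polyint_koornwinderQ polyint_koornwinderR polyint_koornwinderS.
rewrite moveQ moveR moveS !jacobi_orthogonal // !hornerM tX1 vXN1; ring.
Qed.

Lemma genjacobi_at1 a b M N n : (genjacobi a b M N n.+1).[1] =
  'C(n.+1 + a, n.+1)%:R + M * (koornwinderQ_coef a b n * 'C(n + a, n)%:R).
Proof.
have S1 : (koornwinderS R a b n.+1).[1] = 0.
  case: n => [|n]; rewrite ?horner0 // koornwinderS_SS hornerZ.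
  by rewrite (hornerM (tX * vX)) (hornerM tX) tX1 !mul0r mulr0.
rewrite /genjacobi 3!hornerD jacobi_at1 (hornerZ M) (hornerZ N) (hornerZ (M * N)) S1.
rewrite koornwinderQ_S koornwinderR_S !hornerZ (hornerM vX) (hornerM tX) tX1 vX1.
by rewrite jacobi_at1; ring.
Qed.

Lemma genjacobi_dot_vX a b M N n :
  polydot a b M N (genjacobi a b M N n.+2) vX = 0.
Proof.
have moveQ (J : {poly R}) : J * (tX ^+ a * vX ^+ b.+1) * vX =
    J * (tX ^+ a * vX ^+ (b + 2)) * 1 by rewrite addn2 !exprS; ring.
(* Writing v = 1 - t splits off a part with the full exponent a + 2, which orthogonality kills; the
   part with a + 1 is explicit. *)
have moveR (J : {poly R}) : J * (tX ^+ a.+1 * vX ^+ b) * vX =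
    J * (tX ^+ a.+1 * vX ^+ b) - J * (tX ^+ (a + 2) * vX ^+ b) * 1.
  have v1 : vX = 1 - tX :> {poly R} by rewrite -tXvX addrC addKr.
  by rewrite [X in _ * X = _]v1 addn2 !exprS; ring.
have moveS (J : {poly R}) : J * (tX ^+ a.+1 * vX ^+ b.+1) * vX =
    J * (tX ^+ a.+1 * vX ^+ (b + 2)) by rewrite !addn2 !exprS; ring.
rewrite /polydot polyint_genjacobi.
rewrite polyint_koornwinderQ polyint_koornwinderR polyint_koornwinderS.
rewrite moveQ moveR moveS linearB /= !jacobi_orthogonal ?size_vX ?size_poly1 //.
rewrite [in (a + 2)%N]addn2 !polyint_jacobi_predl weight_mass vXN1 vX1 genjacobi_at1.
rewrite (natr_bin (n.+2 + a) _ a) // (natr_bin (n.+1 + a) _ a) //.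
rewrite /koornwinderQ_coef /koornwinderS_coef !addn2 !addSn !addnS.
rewrite (addnC b a) (addnC n a) (addnC n b).
rewrite !(factSR a) !(factSR b).
(* The integral of R cancels the P part of the mass at 1, and that of S cancels the Q part. *)
by field; rewrite !fact_neq0 !nat1r !pnatr_eq0.
Qed.

Lemma genjacobi_dot_tX a b M N n :
  polydot a b M N (genjacobi a b M N n.+2) tX = 0.
Proof.
have := genjacobi_dot_vX b a N M n.
rewrite -polydot_reflect genjacobi_reflect vX_reflect polydotZl => /eqP.
by rewrite mulf_eq0 signr_eq0 => /eqP.
Qed.

Lemma genjacobi_atN1 a b M N n :
  (genjacobi a b M N n).[-1] = (-1) ^+ n * (genjacobi b a N M n).[1].
Proof.
have := congr1 (horner^~ 1) (genjacobi_reflect a b M N n).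
by rewrite hornerZ horner_comp hornerN hornerX.
Qed.

(** Since S_1 = 0, the integrals of Q_1 and R_1 must cancel the terms of the masses linear in [M]
    and in [N]. The two MN terms cancel each other, as [koornwinderQ_coef a b 0] equals a + b + 2,
    symmetric in [a] and [b]. *)
Lemma genjacobi1_dot1 a b M N : polydot a b M N (genjacobi a b M N 1) 1 = 0.
Proof.
rewrite /polydot polyint_genjacobi jacobi_orthogonal ?size_poly1 //.
rewrite polyint_koornwinderQ polyint_koornwinderR !mulr1.
rewrite !addn2 polyint_jacobi_pred polyint_jacobi_predl /koornwinderS !mul0r.
rewrite (linear0 (@polyint R)) weight_mass genjacobi_atN1 !genjacobi_at1 !hornerC.
rewrite (natr_bin (1 + a) _ a) // (natr_bin (1 + b) _ b) // /koornwinderQ_coef.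
rewrite !addSn !add0n !addn0 !addnS !bin0 (addnC b a).
rewrite expr0 expr1 (_ : 1`! = 1)%N // !(factSR a) !(factSR b).
by field; rewrite !fact_neq0 !nat1r !pnatr_eq0.
Qed.

(** Subtracting the linear interpolant at -1 and 1 leaves a polynomial with both endpoints as
    roots. *)
Lemma poly_endpoint_decomp n f : (size f <= n.+2)%N ->
  exists2 g : {poly R}, (size g <= n)%N &
    f = f.[-1] *: tX + f.[1] *: vX + tX * vX * g.
Proof.
move=> size_f; pose h := f - (f.[-1] *: tX + f.[1] *: vX).
have size_h : (size h <= n.+2)%N.
  apply: leq_trans (size_polyD _ _) _; rewrite size_polyN geq_max size_f /=.
  apply: leq_trans (size_polyD _ _) _.
  rewrite geq_max; apply/andP; split; apply: leq_trans (size_scale_leq _ _) _.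
    by rewrite size_tX.
  by rewrite size_vX.
have /factor_theorem[p hE] : root h 1.
  rewrite /root hornerD hornerN hornerD (hornerZ _ tX) (hornerZ _ vX).
  by rewrite tX1 vX1 mulr0 add0r mulr1 subrr.
have /factor_theorem[q pE] : root p (-1).
  have : h.[-1] == 0.
    rewrite hornerD hornerN hornerD (hornerZ _ tX) (hornerZ _ vX).
    by rewrite tXN1 vXN1 mulr0 addr0 mulr1 subrr.
  rewrite hE hornerM mulf_eq0 => /orP[//|].
  by rewrite hornerXsubC => /eqP; lra.
(* Again (x - 1)(x + 1) = -4 t v. *)
have {pE}hE : h = tX * vX * (- 4 *: q).
  rewrite hE pE polyCN opprK polyC1 addX1 subX1; move: tX vX => t v.
  rewrite -!scalerAr -!scalerAl !scalerA; congr (_ *: _); ring.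
exists (- 4 *: q); last by rewrite -hE /h addrC subrK.
(* The exact size of a product, used to bound the cofactor, requires nonzero factors. *)
have [->|q0] := eqVneq q 0; first by rewrite scaler0 size_poly0.
have t0 : tX != 0 :> {poly R} by rewrite -size_poly_gt0 size_tX.
have v0 : vX != 0 :> {poly R} by rewrite -size_poly_gt0 size_vX.
have q40 : - 4 *: q != 0 by rewrite scaler_eq0 negb_or q0 oppr_eq0 pnatr_eq0.
move: size_h; rewrite hE !size_mul ?(mulf_neq0 t0 v0) // size_tX size_vX.
by rewrite /= !addSn /= !ltnS add0n.
Qed.

Lemma genjacobi_dot_small a b M N n f : (size f <= n.+1)%N ->
  polydot a b M N (genjacobi a b M N n.+1) f = 0.
Proof.
case: n => [|n] size_f.
  by rewrite (size1_polyC size_f) -alg_polyC polydotZr genjacobi1_dot1 mulr0.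
have [g size_g ->] := poly_endpoint_decomp _ _ size_f.
rewrite 2!polydotDr (polydotZr _ _ _ _ _ _ tX) (polydotZr _ _ _ _ _ _ vX).
rewrite genjacobi_dot_tX genjacobi_dot_vX.
by rewrite genjacobi_dot_interior // !mulr0 !addr0.
Qed.

Lemma genjacobi_orthogonal a b M N n m : (m < n)%N ->
  polydot a b M N (genjacobi a b M N n) (genjacobi a b M N m) = 0.
Proof.
case: n => // n lt_mn; apply: genjacobi_dot_small.
exact: leq_trans (size_genjacobi _ _ _ _ _) lt_mn.
Qed.
End Orthogonality.

Theorem corollary3p3 (R : realType) (a b : nat) (M N : R)
  (M_gt0 : 0 < M) (N_gt0 : 0 < N) (n m : nat) (n_neq_m : n <> m) :
  genjacobi_dot a b M N
    (fun x => (genjacobi a b M N n).[x])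
    (fun x => (genjacobi a b M N m).[x]) = 0.
Proof.
rewrite genjacobi_dotE; have /eqP := n_neq_m; rewrite neq_ltn => /orP[] lt_nm.
  by rewrite polydotC genjacobi_orthogonal.
exact: genjacobi_orthogonal.
Qed.
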